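(* Let $G\cong(0,1,\underbrace{0,\ldots,0}_{k},1,0,1)$, where $k\ge 1$. Then $q(G)=3$.
   Context: For a simple graph $G$ on $n$ vertices, $S(G)$ is the set of all real symmetric $n\times n$ matrices $A=(a_{ij})$ such that for $i\neq j$, $a_{ij}\neq 0$ if and only if $ij\in E(G)$ (diagonal entries are unrestricted). $q(A)$ is the number of distinct eigenvalues of $A$ and $q(G)=\min\{q(A): A\in S(G)\}$. The notation $G\cong(b_1,\ldots,b_n)$, with $b_i\in\{0,1\}$ and $b_1=0$, means that $G$ is the threshold graph with creation sequence $(b_1,\ldots,b_n)$: its vertices are $v_1,\ldots,v_n$ and, for $i<j$, $v_i$ and $v_j$ are adjacent if and only if $b_j=1$. *)

(* Defs.v *)
From HB Require Import structures.
From mathcomp Require Import all_boot all_order all_algebra.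
From mathcomp Require Import finmap.
From mathcomp Require Import boolp classical_sets cardinality reals.
Set Implicit Arguments.
Unset Strict Implicit.
Unset Printing Implicit Defensive.
Import Order.TTheory GRing.Theory Num.Theory.
Local Open Scope classical_set_scope.
Local Open Scope ring_scope.

Record sgraph (n : nat) := SGraph {
  adj :> rel 'I_n;
  adj_sym : symmetric adj;
  adj_irr : irreflexive adj }.

Definition sg_iso (m n : nat) (G : sgraph m) (H : sgraph n) : Prop :=
  exists f : 'I_m -> 'I_n, bijective f /\ forall x y, H (f x) (f y) = G x y.

Section Threshold.
Variable b : seq bool.

(* Indices start at 0, so the entry of b attached to vertex v_(j+1) is
   nth false b j, and the later of the vertices i and j decides adjacency. *)
Definition threshold_adj : rel 'I_(size b) :=
  fun i j => (i != j) && nth false b (maxn i j).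

Lemma threshold_adj_sym : symmetric threshold_adj.
Proof. by move=> i j; rewrite /threshold_adj eq_sym maxnC. Qed.

Lemma threshold_adj_irr : irreflexive threshold_adj.
Proof. by move=> i; rewrite /threshold_adj eqxx. Qed.

Definition threshold_graph : sgraph (size b) :=
  SGraph threshold_adj_sym threshold_adj_irr.

Lemma threshold_graphE (i j : 'I_(size b)) : (i < j)%N ->
  threshold_graph i j = nth false b j.
Proof.
move=> ij /=; rewrite /threshold_adj -val_eqE /= (ltn_eqF ij) /=.
by rewrite (maxn_idPr (ltnW ij)).
Qed.

End Threshold.

Section MinimumNumberOfDistinctEigenvalues.
Variables (R : realType) (n : nat).

Definition sym_matrices (G : sgraph n) : set 'M[R]_n :=
  [set A | A^T = A /\ forall i j, i != j -> (A i j != 0 <-> G i j)].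

(* fset_set is the empty fset on infinite sets; see finite_spectrum. *)
Definition q_mx (A : 'M[R]_n) : nat :=
  #|` fset_set [set x : R | eigenvalue A x] |.

Lemma finite_spectrum (A : 'M[R]_n) : finite_set [set x : R | eigenvalue A x].
Proof.
have [s sP] : exists s : seq R, [set x | eigenvalue A x] `<=` [set` s].
  apply: contrapT => /forallNP nos.
  have large m : exists s : seq R, [/\ size s = m, uniq s & all (eigenvalue A) s].
    elim: m => [|m [s [ss us As]]]; first by exists [::].
    have /existsNP[x /not_implyP[Ax /negP xs]] := nos s.
    by exists (x :: s); split; rewrite /= ?ss ?xs ?us //; apply/andP; split.
  have [s [ss us As]] := large n.+1.
  have := max_poly_roots (monic_neq0 (char_poly_monic A)) _ us.
  rewrite size_char_poly ss ltnn => /(_ _)/notF; apply.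
  by apply/allP => x /(allP As); rewrite eigenvalue_root_char.
exact: sub_finite_set sP (finite_seq s).
Qed.

Lemma q_mx_attained (G : sgraph n) :
  exists m, `[< exists2 A, sym_matrices G A & q_mx A = m >].
Proof.
pose A : 'M[R]_n := \matrix_(i, j) (G i j)%:R.
exists (q_mx A); apply/asboolP; exists A => //; split.
  by apply/matrixP => i j; rewrite !mxE adj_sym.
by move=> i j _; rewrite mxE pnatr_eq0 eqb0 negbK.
Qed.

Definition q_graph (G : sgraph n) : nat := ex_minn (q_mx_attained G).

End MinimumNumberOfDistinctEigenvalues.

Arguments q_graph R {n} G.

(* Main.v *)
Require Import Defs.
From mathcomp Require Import all_boot all_order all_algebra.
From mathcomp Require Import spectral complex finmap zify ring.
From mathcomp Require Import boolp classical_sets cardinality reals.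
Import Order.TTheory GRing.Theory Num.Theory.
Local Open Scope ring_scope.

(* The vertex z before the dominating vertex d has d as its only neighbour, so
   d is the only common neighbour of z and v_1.  If a symmetric A had at most
   two eigenvalues a, b, then (A - a)(A - b) = 0 by the spectral theorem, but
   its (z, v_1) entry is A_zd A_dv1 <> 0.

   For the upper bound, vertices with the same neighbours outside their class
   are merged, leaving x = {v_1, v_2}, u (the k zeros), w, z, d.  It then
   suffices to find T : 'M_5 with the pattern of G and positive weights D with
   TDTDT = T: spread over the classes it gives A with A^3 = A, hence spectrum in {0, 1, -1}.
   Writing the (w, d) block of (t - A)^-1 as P_+/(t - 1) + P_0/t + P_-/(t + 1)
   with P_+ and P_- of rank 2 and P_0 of rank 1, the sparsity of the rows of u
   and z becomes a condition on the P's; a suitable D makes a solution rational. *)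

(** Over [complex R] the matrix becomes unitarily diagonalisable with a real diagonal. Each diagonal
    entry therefore comes from an eigenvalue of [A], so the product already vanishes on the diagonal
    form. *)
Lemma symmetric_spectrum_pair (R : rcfType) n (A : 'M[R]_n) (a b : R) :
  A^T = A -> (forall x, eigenvalue A x -> x = a \/ x = b) ->
  (A - a%:M) *m (A - b%:M) = 0.
Proof.
move=> symA specA; pose toC : {rmorphism R -> complex R} := real_complex R.
pose B := map_mx toC A.
have realB : B \is a mxOver Num.real.
  by apply/mxOverP => i j; rewrite mxE complex_real.
have symB : B \is symmetricmx.
  by apply/is_hermitianmxP; rewrite expr0 scale1r map_mx_id // map_trmx symA.
have /orthomx_spectralP := symmetric_normalmx symB realB.
have := hermitian_spectral_diag_real (realsym_hermsym symB realB).
have := spectral_unit B.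
set P := spectralmx B; set d := spectral_diag B => Punit /mxOverP realD defB.
have PB : P *m B = diag_mx d *m P by rewrite {1}defB !mulmxA mulmxV // mul1mx.
have dab i : (d 0 i - toC a) * (d 0 i - toC b) = 0.
  have [r dr] : exists r, d 0 i = toC r by apply/complex_realP.
  have : eigenvalue B (d 0 i).
    apply/eigenvalueP; exists (row i P).
      by rewrite -row_mul PB row_mul row_diag_mx -scalemxAl -rowE.
    apply: contraTneq Punit => Pi0; rewrite -row_free_unit; apply/row_freePn.
    by exists i; rewrite Pi0 sub0mx.
  by rewrite dr eigenvalue_map => /specA[] ->; rewrite subrr ?mul0r ?mulr0.
have : map_mx toC ((A - a%:M) *m (A - b%:M)) = 0.
  rewrite map_mxM !map_mxB !map_scalar_mx -/B.
  have shift c : B - c%:M = invmx P *m (diag_mx d - c%:M) *m P.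
    by rewrite mulmxBr mulmxBl -defB mul_mx_scalar -scalemxAl mulVmx // scalemx1.
  rewrite !shift -!mulmxA (mulKVmx Punit) (mulmxA (diag_mx d - _)).
  suff -> : (diag_mx d - (toC a)%:M) *m (diag_mx d - (toC b)%:M) = 0.
    by rewrite mul0mx mulmx0.
  have diagB c : diag_mx d - c%:M = diag_mx (d - const_mx c).
    by rewrite -diag_const_mx -raddfB.
  rewrite !diagB mulmx_diag; apply/matrixP => i j.
  by rewrite !mxE dab mul0rn.
by move/eqP; rewrite map_mx_eq0 => /eqP.
Qed.

Lemma unique_common_neighbor_q_ge3 (R : realType) n (G : sgraph n) (A : 'M[R]_n)
    (i j d : 'I_n) :
  sym_matrices G A -> i != j -> ~~ G i j -> G i d -> G d j ->
  (forall l, G i l -> G l j -> l = d) -> (3 <= q_mx A)%N.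
Proof.
move=> [symA patA] ij Gij Gid Gdj uniq_d; rewrite leqNgt; apply/negP => q_lt3.
have A0 u v : u != v -> ~~ G u v -> A u v = 0.
  by move=> uv; apply: contraNeq => /(patA _ _ uv).
have [a [b specA]] : exists a b, forall x, eigenvalue A x -> x = a \/ x = b.
  have spec x : eigenvalue A x -> x \in fset_set [set x | eigenvalue A x].
    by move=> Ax; rewrite in_fset_set ?inE //; exact: finite_spectrum.
  move: q_lt3 spec; rewrite /q_mx.
  case: (fset_set _) => -[|a [|b [|c s]]] us //= _ spec.
  - by exists 0, 0 => x /spec.
  - by exists a, a => x /spec; rewrite !inE => /eqP; left.
  - by exists a, b => x /spec; rewrite !inE => /orP[/eqP|/eqP]; [left|right].
have /matrixP/(_ i j) := symmetric_spectrum_pair _ _ _ _ _ symA specA.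
have di : d != i by apply: contraTneq Gid => ->; rewrite adj_irr.
have dj : d != j by apply: contraTneq Gdj => ->; rewrite adj_irr.
rewrite mxE (bigD1 d) //= big1 => [|l ld]; last first.
  (* The shifts by [a] and [b] only affect the terms [l = i] and [l = j], and both contain the
     factor [A i j], which is 0 by non-adjacency. *)
  rewrite !mxE; have [->|li] := eqVneq l i.
    by rewrite (A0 i j) // (negPf ij) mulr0n subr0 mulr0.
  have [->|lj] := eqVneq l j.
    by rewrite (A0 i j) //= mulr0n subr0 mul0r.
  rewrite /= !mulr0n !subr0.
  have [Gil|Gil] := boolP (G i l).
    rewrite (A0 l j) ?mulr0 //; apply: contraNN ld => Glj.
    by rewrite (uniq_d l).
  by rewrite (A0 i l) ?mul0r // eq_sym.
rewrite addr0 !mxE (eq_sym i d) (negPf di) (negPf dj) !mulr0n !subr0 => /eqP.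
rewrite mulf_eq0 => /orP[]; apply/negP; apply/patA => //.
by rewrite eq_sym.
Qed.

Lemma cube_id_q_le3 (R : realType) n (A : 'M[R]_n) :
  A *m A *m A = A -> (q_mx A <= 3)%N.
Proof.
move=> A3; rewrite /q_mx; set S := fset_set _.
have /uniq_leq_size : {subset S <= [:: 0; 1; -1 : R]}.
  move=> x; rewrite in_fset_set ?inE; last exact: finite_spectrum.
  move=> /eigenvalueP[y yA y0]; have : y *m (A *m A *m A) = y *m A by rewrite A3.
  rewrite !mulmxA yA -!scalemxAl yA -scalemxAl yA !scalerA => /eqP.
  rewrite -subr_eq0 -scalerBl scaler_eq0 (negPf y0) orbF.
  have -> : x * x * x - x = x * ((x - 1) * (x + 1)) by ring.
  by rewrite !mulf_eq0 subr_eq0 addr_eq0.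
by apply; exact: fset_uniq.
Qed.

(** With [Q] the class incidence matrix whose row [a] is scaled by [s a], the blow-up is
    [Q^T *m T *m Q]. Dividing [w 0 a] by the class size makes [Q *m Q^T] equal to [diag_mx w], so
    the cube collapses to the hypothesis on [T]. *)
Lemma blowup_cube_id (R : rcfType) n m (c : 'I_n -> 'I_m) (w : 'rV[R]_m)
    (T : 'M[R]_m) :
  (forall a, exists i, c i = a) -> (forall a, 0 < w 0 a) ->
  T *m diag_mx w *m T *m diag_mx w *m T = T ->
  exists2 s : 'I_m -> R, forall a, 0 < s a &
    let A := \matrix_(i, j) (s (c i) * s (c j) * T (c i) (c j)) in
    A *m A *m A = A.
Proof.
move=> c_surj w_gt0 TwT; pose card a : R := #|[set i | c i == a]|%:R.
have card_gt0 a : 0 < card a.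
  by rewrite ltr0n; apply/card_gt0P; have [i <-] := c_surj a; exists i; rewrite inE.
pose s a := Num.sqrt (w 0 a / card a).
exists s => [a|]; first by rewrite sqrtr_gt0 divr_gt0.
pose Q : 'M_(m, n) := \matrix_(a, i) ((c i == a)%:R * s a).
have QQ : Q *m Q^T = diag_mx w.
  apply/matrixP => a b; rewrite !mxE; have [<-|ab] := eqVneq a b; last first.
    rewrite mulr0n big1 // => i _; rewrite !mxE.
    by case: eqVneq => [->|]; rewrite ?(negPf ab) !(mul0r, mulr0).
  rewrite (bigID (fun i => c i == a)) /= [X in _ + X]big1 ?addr0; last first.
    by move=> i /negPf cia; rewrite !mxE cia !mul0r.
  under eq_bigr => i cia do rewrite !mxE cia mul1r -expr2 sqr_sqrtr
    ?divr_ge0 ?ltW //.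
  rewrite sumr_const -mulr_natr mulr1n.
  by rewrite [X in _ * X](_ : _ = card a) ?divfK ?gt_eqF // /card cardsE.
move=> A; have -> : A = Q^T *m T *m Q.
  apply/matrixP => i j; rewrite !mxE (bigD1 (c j)) //= [X in _ + X]big1 ?addr0.
    rewrite !mxE (bigD1 (c i)) //= [X in _ + X]big1 ?addr0.
      by rewrite !mxE !eqxx !mul1r mulrAC.
    by move=> a /negPf ia; rewrite !mxE eq_sym ia !mul0r.
  by move=> a /negPf ja; rewrite !mxE [c j == a]eq_sym ja mul0r mulr0.
by rewrite -[in RHS]TwT -QQ !mulmxA.
Qed.

(* 12 T in the header's notation; rows and columns are x, u, w, z, d. *)
Definition core_entry (a b : nat) : int := nth 0 (nth [::]
  [:: [:: -6;  0; -6; 0; -3];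
      [::  0;  0; -1; 0;  1];
      [:: -6; -1;  2; 0;  1];
      [::  0;  0;  0; 6;  9];
      [:: -3;  1;  1; 9; -4]] a) b.

Definition core : 'M[int]_5 := \matrix_(a, b) core_entry a b.

Definition core_weight : 'rV[int]_5 := \row_a nth 0 [:: 1; 24; 2; 1; 1] a.

(** This is TDTDT = T multiplied by 12^3; integer entries let computation decide it. *)
Lemma core_identity :
  core *m diag_mx core_weight *m core *m diag_mx core_weight *m core
  = 144 *: core.
Proof.
rewrite -!mulmxA !mul_diag_mx.
apply/matrixP => a b.
rewrite !(mxE, big_ord_recl, big_ord0) /=.
by case: a => [[|[|[|[|[|]]]]] //= _]; case: b => [[|[|[|[|[|]]]]] //= _].
Qed.

(* Class of the vertex with 0-based index p: 0 for v_1 and v_2, 1 for the block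
   of k zeros, then 2, 3, 4 for the last three vertices. *)
Definition class_of (k p : nat) : nat := maxn (minn p.-1 1) (p - k).

(** Position 0 is excluded because v_1 has bit 0 but shares its class with v_2, whose bit is 1. The
    later of two distinct vertices is never at position 0. *)
Lemma nth_creation_sequence k p : (1 <= k)%N -> (0 < p < k + 5)%N ->
  nth false ([:: false; true] ++ nseq k false ++ [:: true; false; true]) p
  = nth false [:: true; false; true; false; true] (class_of k p).
Proof.
move=> k_gt0 /andP[p_gt0 p_lt].
have [p1|p1] := ltnP 1 p; last first.
  have -> : class_of k p = 0%N by rewrite /class_of; lia.
  by have -> : p = 1%N by lia.
rewrite nth_cat /= ltnNge p1 /= nth_cat size_nseq nth_nseq.
case: ltnP => pk; first by have -> : class_of k p = 1%N by rewrite /class_of; lia.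
have -> : class_of k p = (p - 2 - k).+2 by rewrite /class_of; lia.
by [].
Qed.

(** Diagonal entries matter only for classes 0 and 1, which can contain two distinct vertices: there
    they encode adjacency inside the class. *)
Lemma core_entry_neq0 a b : (a < 5)%N -> (b < 5)%N -> (a == b -> (a <= 1)%N) ->
  (core_entry a b != 0) = nth false [:: true; false; true; false; true] (maxn a b).
Proof.
by case: a => [|[|[|[|[|]]]]] //; case: b => [|[|[|[|[|]]]]] // _ _ /(_ isT).
Qed.

Theorem theorem7p2 (R : realType) (n k : nat) (G : sgraph n)
    (hk : (1 <= k)%N)
    (hG : sg_iso G (threshold_graph
      ([:: false; true] ++ nseq k false ++ [:: true; false; true]))) :
  q_graph R G = 3%N.
Proof.
have sz : size ([:: false; true] ++ nseq k false ++ [:: true; false; true])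
    = (k + 5)%N by rewrite !size_cat size_nseq /=; lia.
have [f [[g gK fK] fG]] := hG.
have f_lt i : (f i < k + 5)%N by rewrite -sz.
have adjG i j : i != j -> G i j =
    nth false [:: true; false; true; false; true] (class_of k (maxn (f i) (f j))).
  move=> ij; rewrite -fG /= /threshold_adj (inj_eq (can_inj gK)) ij /=.
  apply: nth_creation_sequence => //; apply/andP; split; last first.
    by rewrite gtn_max !f_lt.
  rewrite lt0n; apply: contra ij; rewrite -leqn0 geq_max !leqn0.
  move=> /andP[/eqP fi /eqP fj].
  by rewrite -(inj_eq (can_inj gK)) -val_eqE /= fi fj.
have vertex p : (p < k + 5)%N -> exists i, f i = p :> nat.
  by rewrite -sz => p_lt; exists (g (Ordinal p_lt)); rewrite fK.
rewrite /q_graph; case: ex_minnP => q /asboolP[A GA <-] q_min.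
apply/eqP; rewrite eqn_leq; apply/andP; split; last first.
  have [z fz] : exists i, f i = (k + 3)%N :> nat by apply: vertex; lia.
  have [d fd] : exists i, f i = (k + 4)%N :> nat by apply: vertex; lia.
  have [v fv] : exists i, f i = 0%N :> nat by apply: vertex; lia.
  have neq i j : (f i != f j :> nat) -> i != j by apply: contraNneq => ->.
  (* The bit of [z] is 0, so only later vertices can be adjacent to it, and [d] is the only one. *)
  have adj_z i : i != z -> G z i = (i == d).
    move=> iz; rewrite adjG 1?eq_sym // fz -(inj_eq (can_inj gK)) -val_eqE /= fd.
    have [->|fi] := eqVneq (f i : nat) (k + 4)%N.
      by rewrite (_ : class_of k _ = 4%N) // /class_of; lia.
    rewrite (_ : class_of k _ = 3%N) // /class_of.
    by move: (nat_of_ord (f i)) fi (f_lt i) => p /eqP; lia.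
  apply: (unique_common_neighbor_q_ge3 _ _ _ _ z v d GA).
  - by apply: neq; rewrite fz fv; lia.
  - rewrite adj_z; first by apply: neq; rewrite fd fv; lia.
    by apply: neq; rewrite fz fv; lia.
  - by rewrite adj_z //; apply: neq; rewrite fz fd; lia.
  - rewrite adjG ?fd ?fv; last by apply: neq; rewrite fd fv; lia.
    by rewrite (_ : class_of k _ = 4%N) // /class_of; lia.
  - move=> l Gzl _; apply/eqP; rewrite -adj_z //.
    by apply: contraTneq Gzl => ->; rewrite adj_irr.
pose c i : 'I_5 := inord (class_of k (f i)).
have cE i : c i = class_of k (f i) :> nat.
  by rewrite inordK // /class_of; have := f_lt i; lia.
pose T : 'M[R]_5 := 12^-1 *: map_mx intr core.
pose w : 'rV[R]_5 := map_mx intr core_weight.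
have [||| s s_gt0 B3] := blowup_cube_id _ _ _ c w T.
(* Representatives: position 0 for class 0, and [a + k] for every other class [a]. *)
- move=> a; have [|i fi] := vertex (if a == 0%N :> nat then 0%N else (a + k)%N).
    by case: ifP => _; have := ltn_ord a; lia.
  exists i; apply: val_inj; rewrite /= cE fi /class_of.
  by have := ltn_ord a; case: ifP; lia.
- by move=> a; rewrite !mxE ltr0z; case: a => [[|[|[|[|[|]]]]]].
- have := congr1 (map_mx (intr : int -> R)) core_identity.
  rewrite !map_mxM map_mxZ !map_diag_mx -/w => core3.
  rewrite /T !(=^~ scalemxAl, =^~ scalemxAr) core3 !scalerA.
  by congr (_ *: _); rewrite /=; field.
set B := \matrix_(_, _) _ in B3.
apply: leq_trans (cube_id_q_le3 _ _ _ B3); apply: q_min; apply/asboolP.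
exists B => //; split.
  have sym_core (a b : 'I_5) : core_entry a b = core_entry b a.
    by case: a => [[|[|[|[|[|]]]]] //= _]; case: b => [[|[|[|[|[|]]]]] //= _].
  by apply/matrixP => i j; rewrite !mxE sym_core [s (c j) * _]mulrC.
move=> i j ij; have fij : f i != f j :> nat.
  by rewrite val_eqE (inj_eq (can_inj gK)).
(* [class_of k] is monotone, hence commutes with [maxn]. *)
rewrite adjG // (_ : class_of k _ = maxn (c i) (c j)); last first.
  by rewrite !cE /class_of; lia.
rewrite -core_entry_neq0 //; last by rewrite !cE /class_of; lia.
rewrite !mxE !mulf_eq0 !(gt_eqF (s_gt0 _)) invr_eq0 (gt_eqF (ltr0n _ 12)) /=.
by rewrite intr_eq0.
Qed.
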